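(* Let $G$ be a group, $R$ a commutative $G$-graded ring with nonzero unity, $M$ a nonzero $G$-graded $R$-module, and $K$ a graded special $r$-submodule of $M$. Then $h(M)\cap K\subseteq T(M)$.
   Context: A commutative ring $R$ is $G$-graded if $R=\bigoplus_{g\in G}R_g$ with additive subgroups $R_g$ satisfying $R_gR_h\subseteq R_{gh}$; an $R$-module $M$ is $G$-graded if $M=\bigoplus_{g\in G}M_g$ with additive subgroups $M_g$ satisfying $R_gM_h\subseteq M_{gh}$. Put $h(R)=\bigcup_{g\in G}R_g$ and $h(M)=\bigcup_{g\in G}M_g$. An $R$-submodule $K$ of $M$ is graded if $K=\bigoplus_{g\in G}(K\cap M_g)$. Notation: $(K:_R M)=\{r\in R: rM\subseteq K\}$; $Ann_R(x)=\{r\in R: rx=0\}$ for $x\in M$; $T(M)=\{x\in M: Ann_R(x)\neq\{0\}\}$. A proper graded $R$-submodule $K$ of $M$ is a graded special $r$-submodule if whenever $a\in h(R)$ and $x\in h(M)$ satisfy $ax\in K$ and $Ann_R(x)=\{0\}$, then $a\in(K:_R M)$. *)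

(* Defs.v *)
From mathcomp Require Import all_boot all_order all_algebra.
From mathcomp Require Import all_classical.

Set Implicit Arguments.
Unset Strict Implicit.
Unset Printing Implicit Defensive.

Import GRing.Theory.

Local Open Scope classical_set_scope.
Local Open Scope ring_scope.

Section DirectSum.
Context {I : choiceType} {V : zmodType}.

Definition finsupp_families (A : I -> set V) : set (I -> V) :=
  [set f | (forall i, A i (f i)) /\ finite_set [set i | f i != 0]].

(* N is the internal direct sum of the A i: summation is a bijection from
   the external direct sum of the A i onto N. *)
Definition is_direct_sum (N : set V) (A : I -> set V) : Prop :=
  set_bij (finsupp_families A) N (fun f => \sum_(i \in [set: I]) f i).

End DirectSum.

Definition homogeneous {I V : Type} (A : I -> set V) : set V :=
  \bigcup_i A i.

Definition graded_ring (G : groupType) (R : comNzRingType)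
    (Rg : G -> set R) : Prop :=
  [/\ forall g, GRing.zmod_closed [in Rg g],
      is_direct_sum [set: R] Rg &
      forall g h a b, Rg g a -> Rg h b -> Rg (g * h)%g (a * b)].

Definition graded_module (G : groupType) (R : comNzRingType)
    (Rg : G -> set R) (M : lmodType R) (Mg : G -> set M) : Prop :=
  [/\ forall g, GRing.zmod_closed [in Mg g],
      is_direct_sum [set: M] Mg &
      forall g h a x, Rg g a -> Mg h x -> Mg (g * h)%g (a *: x)].

Definition graded_submodule (G : groupType) (R : comNzRingType)
    (M : lmodType R) (Mg : G -> set M) (K : set M) : Prop :=
  GRing.submod_closed [in K] /\ is_direct_sum K (fun g => K `&` Mg g).

Section Annihilators.
Context {R : comNzRingType} {M : lmodType R}.

(* The residual (K :_R M). *)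
Definition colon (K : set M) : set R :=
  [set r | [set r *: x | x in [set: M]] `<=` K].

Definition Ann (x : M) : set R := [set r | r *: x = 0].

End Annihilators.

Definition torsion (R : comNzRingType) (M : lmodType R) : set M :=
  [set x | Ann x <> [set 0]].
Arguments torsion {R} M.

Definition graded_special_r_submodule (G : groupType) (R : comNzRingType)
    (Rg : G -> set R) (M : lmodType R) (Mg : G -> set M) (K : set M) : Prop :=
  [/\ graded_submodule Mg K,
      K <> [set: M] &
      forall a x, homogeneous Rg a -> homogeneous Mg x ->
        K (a *: x) -> Ann x = [set 0] -> colon K a].

(* Main.v *)
Require Import Defs.
From mathcomp Require Import all_boot all_order all_algebra.
From mathcomp Require Import all_classical.

(** If a homogeneous [x] of [K] had zero annihilator, then every homogeneous
    scalar [a] would satisfy [a *: x \in K], hence [a \in (K : M)] because [K]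
    is a special r-submodule.  The unity is a sum of homogeneous scalars and
    [(K : M)] is closed under sums, so [1 \in (K : M)], that is [K = M], which
    contradicts properness.  The argument is applied to the
    homogeneous components of [1], since a homogeneous [a] is all that the
    special r-submodule condition accepts. *)

Local Open Scope classical_set_scope.
Local Open Scope ring_scope.

(** This is how a property of homogeneous elements reaches all of [V], in
    particular the unity of a graded ring. *)
Lemma homogeneous_generate {I : choiceType} {V : zmodType} {A : I -> set V}
    {P : set V} (P0 : P 0) (PD : forall u v, P u -> P v -> P (u + v)) :
  is_direct_sum [set: V] A -> homogeneous A `<=` P -> P = [set: V].
Proof.
move=> [_ _ sum_surj] AP; apply/seteqP; split=> // v _.
have [f [Af _] <-] := sum_surj v Logic.I.
by apply: big_ind => // i _; apply: AP; exists i.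
Qed.

Section Colon.
Context {R : comNzRingType} {M : lmodType R} {K : set M}.
Context (K_submod : GRing.submod_closed [in K]).

Lemma submod_lin a u v : K u -> K v -> K (a *: u + v).
Proof.
case: K_submod => _ Klin /mem_set Ku /mem_set Kv.
by apply: set_mem; apply: Klin.
Qed.

Lemma submod0 : K 0.
Proof. by case: K_submod => K0 _; apply: set_mem. Qed.

Lemma submodZ a u : K u -> K (a *: u).
Proof.
by move=> Ku; rewrite -[_ *: _]GRing.addr0; exact: submod_lin Ku submod0.
Qed.

Lemma colon0 : colon K 0.
Proof. by move=> _ [y _ <-]; rewrite GRing.scale0r; exact: submod0. Qed.

Lemma colonD a b : colon K a -> colon K b -> colon K (a + b).
Proof.
move=> Ka Kb _ [y _ <-]; rewrite GRing.scalerDl -[a *: y]GRing.scale1r.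
by apply: submod_lin; [apply: Ka | apply: Kb]; exists y.
Qed.

End Colon.

Lemma colon1 {R : comNzRingType} {M : lmodType R} (K : set M) :
  colon K 1 -> K = [set: M].
Proof.
move=> K1; apply/seteqP; split=> // y _.
by apply: K1; exists y => //; rewrite GRing.scale1r.
Qed.

Theorem theorem4p5 (G : groupType) (R : comNzRingType) (Rg : G -> set R)
    (M : lmodType R) (Mg : G -> set M) (K : set M)
    (R_graded : graded_ring Rg)
    (M_nonzero : exists x : M, x != 0)
    (M_graded : graded_module Rg Mg)
    (K_special : graded_special_r_submodule Rg Mg K) :
  homogeneous Mg `&` K `<=` torsion M.
Proof.
case: R_graded => _ R_sum _; case: K_special => [[K_submod _] K_proper K_r].
move=> x [x_hom Kx] Annx; apply/K_proper/colon1.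
have -> // : colon K = [set: R].
apply: (homogeneous_generate (colon0 K_submod) (colonD K_submod) R_sum).
by move=> a a_hom; exact: (K_r a x a_hom x_hom (submodZ K_submod a x Kx) Annx).
Qed.
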